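(* Let $d \geq 1$ be an integer. The endpoint Strichartz estimate $$\|f\|_{L^2_tL^{\frac{2d}{d-1}}_xL^{\frac{2d}{d+1}}_v} \lesssim \|f^0\|_{L^2_{x,v}}$$ for the kinetic transport equation fails. That is, there is no finite constant $C$ (depending only on $d$) such that for every $f^0 \in L^2(\mathbb{R}^d \times \mathbb{R}^d)$ the solution $f(t,x,v) = f^0(x-tv,v)$, $(t,x,v) \in \mathbb{R}\times\mathbb{R}^d\times\mathbb{R}^d$, of the kinetic transport equation with initial data $f^0$ satisfies $$\|f\|_{L^2_tL^{\frac{2d}{d-1}}_xL^{\frac{2d}{d+1}}_v} \leq C\, \|f^0\|_{L^2_{x,v}}.$$
   Context: The kinetic transport equation is $$\partial_t f(t,x,v) + v \cdot \nabla_x f(t,x,v) = 0, \qquad f(0,x,v) = f^0(x,v),$$ for $(t,x,v) \in \mathbb{R} \times \mathbb{R}^d \times \mathbb{R}^d$; its solution is $f(t,x,v) = f^0(x-tv,v)$. The mixed norm is $$\|f\|_{L^q_tL^p_xL^r_v} = \left( \int_{\mathbb{R}} \left( \int_{\mathbb{R}^d} \left( \int_{\mathbb{R}^d} |f(t,x,v)|^r \, \mathrm{d}v \right)^{p/r} \mathrm{d}x \right)^{q/p} \mathrm{d}t \right)^{1/q},$$ with values in $[0,\infty]$ and with the usual modification (essential supremum) when an exponent is $\infty$. For $d=1$ the exponent $\frac{2d}{d-1}$ is interpreted as $\infty$, so that the norm in $x$ is $L^\infty_x$. Also $\|f^0\|_{L^2_{x,v}} = \left( \int_{\mathbb{R}^d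 \times \mathbb{R}^d} |f^0(x,v)|^2 \, \mathrm{d}x\,\mathrm{d}v \right)^{1/2}$. The notation $X \lesssim Y$ means $X \leq CY$ for some finite constant $C$ depending at most on the dimension $d$ and the (here fixed) Lebesgue exponents. *)

(* Defs.v *)
From HB Require Import structures.
From mathcomp Require Import all_boot all_order all_algebra.
From mathcomp Require Import all_classical all_reals all_analysis.

Set Implicit Arguments.
Unset Strict Implicit.
Unset Printing Implicit Defensive.
Import Order.TTheory GRing.Theory Num.Theory.
Import numFieldNormedType.Exports.

Local Open Scope classical_set_scope.
Local Open Scope ring_scope.

(* The space R^n is 'rV[R]_n, with the sigma-algebra generated by the n
   coordinate projections (the Borel sigma-algebra of R^n), built like the
   library's sigma-algebra on n.-tuple R. *)
Definition rV_display : measure_display -> measure_display.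
Proof. exact. Qed.

Section measurable_rV.
Context {R : realType} (n : nat).

Let coors : 'I_n -> 'rV[R]_n -> R := fun i x => x ord0 i.

Let rV_set0 : g_sigma_preimage coors set0.
Proof. exact: sigma_algebra0. Qed.

Let rV_setC A : g_sigma_preimage coors A -> g_sigma_preimage coors (~` A).
Proof. exact: sigma_algebraC. Qed.

Let rV_bigcup (F : _^nat) : (forall i, g_sigma_preimage coors (F i)) ->
  g_sigma_preimage coors (\bigcup_i (F i)).
Proof. exact: sigma_algebra_bigcup. Qed.

HB.instance Definition _ := @isMeasurable.Build (rV_display default_measure_display)
  'rV[R]_n (g_sigma_preimage coors) rV_set0 rV_setC rV_bigcup.

End measurable_rV.

Section measurable_fun_rV.
Context {R : realType}.

Lemma measurable_coord n (i : 'I_n) :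
  measurable_fun [set: 'rV[R]_n] (fun x : 'rV[R]_n => x ord0 i).
Proof.
move=> _ Y mY; rewrite setTI; apply: sub_sigma_algebra => /=.
rewrite -bigcup_seq/=; exists i => /=; first by rewrite mem_index_enum.
by exists Y => //; rewrite setTI.
Qed.

Lemma measurable_fun_coordP d (T : measurableType d) n (f : T -> 'rV[R]_n) :
  measurable_fun [set: T] f <->
  forall i, measurable_fun [set: T] (fun t => f t ord0 i).
Proof.
split=> [mf i|mf].
  exact: (measurableT_comp (measurable_coord i) mf).
move=> _ A mA; rewrite setTI; move: A mA.
pose G := [set A : set 'rV[R]_n | measurable (f @^-1` A)].
suff mG : measurable `<=` G by move=> A /mG.
apply: smallest_sub.
  split => /=.
  - by rewrite /G/= preimage_set0; exact: measurable0.
  - move=> A GA; rewrite /G/= setTD preimage_setC; exact: measurableC.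
  - move=> F GF; rewrite /G/= preimage_bigcup.
    by apply: bigcup_measurable => k _; exact: GF.
rewrite -bigcup_seq => A [i _ [B mB <-]]; rewrite /G/= setTI.
by have := mf i measurableT _ mB; rewrite setTI.
Qed.

End measurable_fun_rV.

(* Lebesgue measure on R^n, by recursion: a point mass on R^0, and the image
   of the product measure under R * R^n ~ R^(n+1) afterwards.  It is the
   sigma-finite measure giving boxes their volume, see [lebesgue_rV_box]. *)
Definition rV_cons {R : realType} n (p : R * 'rV[R]_n) : 'rV[R]_n.+1 :=
  row_mx (p.1%:M : 'rV_1) p.2.

Section rV_cons_lemmas.
Context {R : realType} (n : nat).

Lemma rV_cons0 (p : R * 'rV[R]_n) : rV_cons p ord0 ord0 = p.1.
Proof.
transitivity (row_mx (p.1%:M : 'rV_1) p.2 ord0 (lshift n ord0)).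
  by congr (row_mx _ _ _ _); exact/val_inj.
by rewrite row_mxEl mxE.
Qed.

Lemma rV_consS (p : R * 'rV[R]_n) (i : 'I_n) :
  rV_cons p ord0 (lift ord0 i) = p.2 ord0 i.
Proof.
transitivity (row_mx (p.1%:M : 'rV_1) p.2 ord0 (rshift 1 i)).
  by congr (row_mx _ _ _ _); exact/val_inj.
by rewrite row_mxEr.
Qed.

Lemma measurable_rV_cons : measurable_fun [set: R * 'rV[R]_n] (@rV_cons R n).
Proof.
apply/measurable_fun_coordP => i; have [j ->|->] := unliftP ord0 i.
  under eq_fun do rewrite rV_consS.
  exact: (measurableT_comp (measurable_coord j) measurable_snd).
under eq_fun do rewrite rV_cons0.
exact: measurable_fst.
Qed.

End rV_cons_lemmas.

Section lebesgue_rVS.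
Context {R : realType} (n : nat).
Variable mu : {sigma_finite_measure set 'rV[R]_n -> \bar R}.
Local Open Scope ereal_scope.

Definition lebesgue_rVS : set 'rV[R]_n.+1 -> \bar R :=
  pushforward (@lebesgue_measure R \x mu) (@rV_cons R n).

Let lebesgue_rVS0 : lebesgue_rVS set0 = 0.
Proof. by rewrite /lebesgue_rVS /pushforward preimage_set0 measure0. Qed.

Let lebesgue_rVS_ge0 A : 0 <= lebesgue_rVS A.
Proof. by rewrite /lebesgue_rVS /pushforward; exact: measure_ge0. Qed.

Let mcons (A : set 'rV[R]_n.+1) :
  measurable A -> measurable (@rV_cons R n @^-1` A).
Proof.
by move=> mA; rewrite -[X in measurable X]setTI; exact: measurable_rV_cons.
Qed.

Let lebesgue_rVS_sigma_additive : semi_sigma_additive lebesgue_rVS.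
Proof.
move=> F mF tF mUF; rewrite /lebesgue_rVS /pushforward preimage_bigcup.
apply: measure_semi_sigma_additive.
- by move=> k; exact: mcons.
- apply/trivIsetP => /= i j _ _ ij; rewrite -preimage_setI.
  by move/trivIsetP : tF => /(_ _ _ _ _ ij) ->//; rewrite preimage_set0.
- by rewrite -preimage_bigcup; exact: mcons.
Qed.

HB.instance Definition _ := isMeasure.Build _ _ _ lebesgue_rVS
  lebesgue_rVS0 lebesgue_rVS_ge0 lebesgue_rVS_sigma_additive.

Let rV_uncons (x : 'rV[R]_n.+1) : R * 'rV[R]_n :=
  (x ord0 ord0, \row_i x ord0 (lift ord0 i)).

Let measurable_rV_uncons : measurable_fun [set: 'rV[R]_n.+1] rV_uncons.
Proof.
apply: measurable_fun_pair; first exact: measurable_coord.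
apply/measurable_fun_coordP => i.
by under eq_fun do rewrite mxE; exact: measurable_coord.
Qed.

Let rV_consK : cancel (@rV_cons R n) rV_uncons.
Proof.
move=> [a x]; rewrite /rV_uncons rV_cons0; congr pair.
by apply/rowP => i; rewrite mxE rV_consS.
Qed.

Let lebesgue_rVS_sigma_finite : sigma_finite setT lebesgue_rVS.
Proof.
have /sigma_finiteP[F [TF ndF Foo]] := sigma_finiteT (@lebesgue_measure R).
have /sigma_finiteP[G [TG ndG Goo]] := sigma_finiteT mu.
exists (fun k => rV_uncons @^-1` (F k `*` G k)).
  rewrite -preimage_bigcup -(preimage_setT rV_uncons); congr (_ @^-1` _).
  rewrite -setXTT TF TG predeqE => -[x y]; split; last first.
    by move=> [k _ []/= ? ?]; split; exists k.
  move=> [/= [k _ Fkx] [l _ Gly]]; exists (maxn k l) => //; split.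
  - by move: x Fkx; exact/subsetPset/ndF/leq_maxl.
  - by move: y Gly; exact/subsetPset/ndG/leq_maxr.
move=> k; have [mF Fk] := Foo k; have [mG Gk] := Goo k; split.
  rewrite -[X in measurable X]setTI; apply: measurable_rV_uncons => //.
  exact: measurableX.
have rV_consE : rV_uncons \o @rV_cons R n = id.
  by apply/funext => p; exact: rV_consK.
rewrite /lebesgue_rVS /pushforward -comp_preimage rV_consE preimage_id.
by rewrite product_measure1E// lte_mul_pinfty// ge0_fin_numE.
Qed.

HB.instance Definition _ := Measure_isSigmaFinite.Build _ _ _ lebesgue_rVS
  lebesgue_rVS_sigma_finite.

Lemma lebesgue_rVS_box (A : 'I_n.+1 -> set R) : (forall i, measurable (A i)) ->
  lebesgue_rVS [set x | forall i, A i (x ord0 i)] =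
  lebesgue_measure (A ord0) *
    mu [set x : 'rV[R]_n | forall i, A (lift ord0 i) (x ord0 i)].
Proof.
move=> mA; rewrite -product_measure1E; [|exact: mA|]; last first.
  rewrite (_ : [set _ | _] = \bigcap_(i in [set: 'I_n])
      ((fun x : 'rV[R]_n => x ord0 i) @^-1` A (lift ord0 i))); last first.
    by apply/seteqP; split => x /= H i *; exact: H.
  apply: fin_bigcap_measurable => // i _.
  by rewrite -[X in measurable X]setTI; exact: measurable_coord.
rewrite /lebesgue_rVS /pushforward; congr (product_measure1 _ _ _).
apply/seteqP; split => [[a x]/= H|[a x]/= [Ha Hx] i].
  split => [|i]; first by have := H ord0; rewrite rV_cons0.
  by have := H (lift ord0 i); rewrite rV_consS.
by have [j ->|->] := unliftP ord0 i; rewrite ?rV_consS ?rV_cons0.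
Qed.

End lebesgue_rVS.

Fixpoint lebesgue_rV {R : realType} n :
    {sigma_finite_measure set 'rV[R]_n -> \bar R} :=
  match n with
  | 0 => dirac (0 : 'rV[R]_0)
  | n'.+1 => lebesgue_rVS (lebesgue_rV n')
  end.

Lemma lebesgue_rV_box {R : realType} n (A : 'I_n -> set R) :
  (forall i, measurable (A i)) ->
  (lebesgue_rV n [set x | forall i, A i (x ord0 i)] =
   \prod_(i < n) lebesgue_measure (A i))%E.
Proof.
elim: n A => [|n IH] A mA.
  rewrite big_ord0/= diracE mem_set//= => -[] //.
rewrite big_ord_recl -(IH (fun i => A (lift ord0 i)))//.
exact: lebesgue_rVS_box.
Qed.

Section kinetic_transport.
Context {R : realType} (d : nat).

(* The solution of d_t f + v . grad_x f = 0, f(0, x, v) = f0 (x, v), given by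
   the characteristics. *)
Definition transport (f0 : 'rV[R]_d * 'rV[R]_d -> R)
    (t : R) (x v : 'rV[R]_d) : R :=
  f0 (x - t *: v, v).

(* An exponent +oo makes the corresponding [Lnorm] an essential supremum. *)
Definition mixed_norm (q p r : \bar R)
    (f : R -> 'rV[R]_d -> 'rV[R]_d -> R) : \bar R :=
  ('N[lebesgue_measure]_q [(fun t =>
    'N[lebesgue_rV d]_p [(fun x =>
      'N[lebesgue_rV d]_r [(fun v => (f t x v)%:E)])])])%E.

End kinetic_transport.

(* By convention the exponent 2d/(d-1) is infinite when d = 1. *)
Definition endpoint_x {R : realType} (d : nat) : \bar R :=
  if d == 1%N then +oo%E else ((2 * d)%N%:R / d.-1%:R)%:E.

Definition endpoint_v {R : realType} (d : nat) : \bar R :=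
  ((2 * d)%N%:R / d.+1%:R)%:E.

(* Main.v *)
Require Import Defs.
From mathcomp Require Import all_boot all_order all_algebra.
From mathcomp Require Import all_classical all_reals all_analysis.
From mathcomp Require Import measurable_realfun ess_sup_inf.
From mathcomp Require Import ring lra.

(** The endpoint estimate fails by a power of a logarithm, as is seen on data
    carried by free particles that all pass near the origin during [0, 1].

    Let r = 2d/(d+1) be the velocity exponent.  Choose disjoint cubes S_k of
    velocities (of size about 4^k, volume 4^(kd)) and let E_k be the set of
    (x, v), v in S_k, such that the particle that starts at x with velocity v
    comes within distance O(1) of the origin during [0, 1].  For fixed v this
    is a tube of width O(1) around a segment of length O(4^k), so |E_k| is at
    most of order 4^(k(d+1)).  Take f0 = sum_(k < n) 4^(-k(d+1)/2) 1_(E_k).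

    - Each E_k contributes 4^(-k(d+1)) |E_k| = O(1) to the square of the
      L^2 norm, which is therefore O(n^(1/2)) ([L2norm_datum_le]).
    - For t in [0, 1] and x in the unit cube, (x - t v, v) belongs to E_k
      for every v in S_k ([tube_flow]): f(t, x, .) is the full sum
      sum_k 4^(-k(d+1)/2) 1_(S_k).  Each S_k contributes
      4^(-k(d+1)r/2) |S_k| = 1 to the r-th power of its L^r norm, which is
      thus n^(1/r).  As this holds on a set of (t, x) of unit measure, the
      mixed norm is at least n^(1/r), whatever the exponents in t and x are
      ([mixed_norm_datum_ge]).

    Since 1/r = 1/2 + 1/(2d) > 1/2, no constant C satisfies
    n^(1/r) <= C n^(1/2) for all n. *)

Set Implicit Arguments.
Unset Strict Implicit.
Unset Printing Implicit Defensive.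
Import Order.TTheory GRing.Theory Num.Theory.
Import numFieldNormedType.Exports.

Local Open Scope classical_set_scope.
Local Open Scope ring_scope.

(** * Lower bounds and exact values of L^p norms *)

Section Lnorm_tools.
Context {d} {T : measurableType d} {R : realType}.
Variable mu : {measure set T -> \bar R}.

(** The inner norms of a mixed norm are functions of the outer variables that
    are only known from below on a set, so monotonicity is read off the
    definition of the integral as a supremum over simple functions. *)
Lemma ge0_le_integral_pointwise (f g : T -> \bar R) :
  (forall x, 0 <= f x)%E -> (forall x, f x <= g x)%E ->
  (\int[mu]_x f x <= \int[mu]_x g x)%E.
Proof.
move=> f0 fg; have g0 x : (0 <= g x)%E by exact: le_trans (fg x).
rewrite !ge0_integralTE// ge_ereal_sup// => _ [h /= hf <-].
by apply: ereal_sup_ubound; exists h => // x; exact: le_trans (fg x).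
Qed.

(** Unit measure makes the lower bound independent of the exponent; this is
    how the two outer norms of the mixed norm are discarded, the case d = 1
    (essential supremum in x) included. *)
Lemma Lnorm_ge_unit (p c : \bar R) (A : set T) (f : T -> \bar R) :
  (0 < p)%E -> (0 <= c)%E -> measurable A -> mu A = 1%E ->
  (forall x, A x -> c <= `|f x|)%E -> (c <= 'N[mu]_p[f])%E.
Proof.
move=> p0 c0 mA muA cf.
have muT : (0 < mu setT)%E.
  by rewrite (@lt_le_trans _ _ (mu A)) ?muA// -muA le_measure ?inE.
rewrite unlock; case: p p0 => [p|_|//].
  rewrite lte_fin => p0.
  rewrite -[leLHS]poweRe1// -(mulfV (lt0r_neq0 p0)) poweRrM.
  have cp0 : (0 <= c `^ p)%E by exact: poweR_ge0.
  apply: gt0_ler_poweR; rewrite ?invr_ge0 ?(ltW p0)//.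
  - by rewrite in_itv/= cp0 leey.
  - by rewrite in_itv/= leey andbT integral_ge0// => x _; exact: poweR_ge0.
  rewrite -[leLHS]mule1 -muA -integral_cst// integral_mkcond.
  apply: ge0_le_integral_pointwise => x; rewrite patchE; case: ifPn => //= xA.
  - apply: gt0_ler_poweR; rewrite ?(ltW p0)// ?in_itv/= ?leey ?andbT//.
    by apply: cf; rewrite inE in xA.
  - exact: poweR_ge0.
(* p = +oo: the set where f exceeds its essential supremum is negligible,
   and would contain A. *)
rewrite muT leNgt; apply/negP => lt_c.
have : mu.-negligible A.
  apply: negligibleS (ess_sup_ge mu (abse \o f)) => x /= Ax /le_lt_trans.
  by move=> /(_ _ lt_c); rewrite ltNge cf.
move=> /(measure_negligible mA) muA0; have /eqP : 1%E = 0%E :> \bar R.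
  by rewrite -muA.
by rewrite onee_eq0.
Qed.

(** At each point at most one term of the sum is nonzero; p != 0 makes the
    power vanish where the sum does. *)
Lemma powR_sum_indic (p : R) n (a : nat -> R) (A : nat -> set T) x :
  p != 0 -> trivIset setT A ->
  (\sum_(k < n) a k * \1_(A k) x) `^ p = \sum_(k < n) a k `^ p * \1_(A k) x.
Proof.
move=> p0 tA.
have [[k Akx]|noA] := pselect (exists k : 'I_n, A k x); last first.
  have A0 (k : 'I_n) : (\1_(A k) x : R) = 0.
    by rewrite indicE memNset// => Akx; apply: noA; exists k.
  by rewrite !big1 ?powR0// => k _; rewrite A0 mulr0.
have A0 (j : 'I_n) : j != k -> (\1_(A j) x : R) = 0.
  move=> jk; rewrite indicE memNset// => Ajx.
  move/negP : jk; apply; apply/eqP/val_inj/(tA j k) => //.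
  by exists x.
rewrite (bigD1 k)//= [in RHS](bigD1 k)//= [X in _ + X]big1 => [|j jk].
  rewrite [X in _ = _ + X]big1 => [|j jk]; last by rewrite A0// mulr0.
  by rewrite indicE mem_set// !addr0 !mulr1.
by rewrite A0// mulr0.
Qed.

Lemma Lnorm_sum_indic (p : R) n (a : nat -> R) (A : nat -> set T) :
  0 < p -> (forall k, 0 <= a k) -> (forall k, measurable (A k)) ->
  trivIset setT A ->
  ('N[mu]_p%:E[(fun x => (\sum_(k < n) a k * \1_(A k) x)%:E)] =
   (\sum_(k < n) (a k `^ p)%:E * mu (A k)) `^ p^-1)%E.
Proof.
move=> p0 a0 mA tA; rewrite unlock; congr (_ `^ _)%E.
transitivity (\int[mu]_x \sum_(k < n) (a k `^ p * \1_(A k) x)%:E)%E.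
  apply: eq_integral => x _.
  rewrite abse_EFin ger0_norm; last first.
    by apply: sumr_ge0 => k _; rewrite mulr_ge0.
  by rewrite poweR_EFin powR_sum_indic ?gt_eqF// -sumEFin.
rewrite ge0_integral_sum//; last 2 first.
- by move=> k; apply/measurable_EFinP; apply: measurable_funM.
- by move=> k x _; rewrite lee_fin mulr_ge0// powR_ge0.
apply: eq_bigr => k _; under eq_integral do rewrite EFinM.
rewrite ge0_integralZl_EFin ?powR_ge0//.
  by rewrite integral_indic// setIT.
by apply/measurable_EFinP; exact: measurable_indic.
Qed.

End Lnorm_tools.

(** * Shells of velocities and tubes of positions *)

(** The product measure is defined by slicing along the first variable; the
    sets below are sheared in x and have simple slices at fixed velocity. *)
Lemma product_measure_ysection d1 d2 (T1 : measurableType d1)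
    (T2 : measurableType d2) (R : realType)
    (m1 : {sigma_finite_measure set T1 -> \bar R})
    (m2 : {sigma_finite_measure set T2 -> \bar R}) (A : set (T1 * T2)) :
  measurable A -> ((m1 \x m2) A = \int[m2]_y m1 (ysection A y))%E.
Proof.
move=> mA; rewrite -[LHS](_ : \int[m1 \x m2]_z (\1_A z)%:E = _)%E.
  rewrite indic_fubini_tonelli1// indic_fubini_tonelli//.
  by rewrite indic_fubini_tonelli_GE.
by rewrite integral_indic// setIT.
Qed.

Section boxes.
Context {R : realType} (d : nat).
Implicit Types (x v : 'rV[R]_d) (a b c : R).

Definition cube a b : set 'rV[R]_d := [set x | forall i, x ord0 i \in `[a, b[].

Lemma measurable_coords d' (T : measurableType d') (f : 'I_d -> T -> R)
    (A : 'I_d -> set R) :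
  (forall i, measurable_fun setT (f i)) -> (forall i, measurable (A i)) ->
  measurable [set z | forall i, A i (f i z)].
Proof.
move=> mf mA; rewrite (_ : [set _ | _] =
    \bigcap_(i in [set: 'I_d]) (f i @^-1` A i)); last first.
  by apply/seteqP; split => z /= H i *; exact: H.
apply: fin_bigcap_measurable => // i _.
by rewrite -[X in measurable X]setTI; exact: mf.
Qed.

Lemma measurable_cube a b : measurable (cube a b).
Proof.
by apply: (measurable_coords (f := fun i x => x ord0 i)
  (A := fun=> `[a, b[%classic)) => // i; exact: measurable_coord.
Qed.

Lemma lebesgue_rV_translated_cube (w : 'I_d -> R) a b : a <= b ->
  lebesgue_rV d [set x : 'rV[R]_d | forall i, x ord0 i + w i \in `[a, b[] =
  ((b - a) ^+ d)%:E.
Proof.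
move=> ab; transitivity (lebesgue_rV d
    [set x : 'rV[R]_d | forall i, x ord0 i \in `[a - w i, b - w i[]).
  by congr (lebesgue_rV d _); apply/seteqP;
    split => x /= + i => /(_ i); rewrite !in_itv/= => ?; lra.
rewrite (lebesgue_rV_box (A := fun i => `[a - w i, b - w i[%classic))//.
transitivity (\prod_(i < d) (b - a)%:E)%E; last first.
  by rewrite prodEFin prodr_const card_ord.
apply: eq_bigr => i _; rewrite lebesgue_measure_itv/= lte_fin.
have [lt|ge] := ltP; first by rewrite -EFinB; congr (_%:E); lra.
by congr (_%:E); lra.
Qed.

Lemma lebesgue_rV_cube a b : a <= b ->
  lebesgue_rV d (cube a b) = ((b - a) ^+ d)%:E.
Proof.
move=> ab; rewrite -(lebesgue_rV_translated_cube (fun=> 0) ab).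
by congr (lebesgue_rV d _); apply/seteqP; split => x /= + i => /(_ i);
  rewrite addr0.
Qed.

(** A cube in the sector of positive coordinates stands for the annulus of
    velocities of speed about [4 ^+ k]: its volume is explicit. *)
Definition shell k : set 'rV[R]_d := cube (4 ^+ k) (2 * 4 ^+ k).

Lemma exp4_gt0 k : 0 < 4 ^+ k :> R. Proof. exact: exprn_gt0. Qed.
#[local] Hint Resolve exp4_gt0 : core.

Lemma lebesgue_shell k : lebesgue_rV d (shell k) = ((4 ^+ k) ^+ d)%:E.
Proof.
have k0 := exp4_gt0 k; rewrite lebesgue_rV_cube; last by lra.
by congr ((_ ^+ d)%:E); lra.
Qed.

Lemma trivIset_shell : (0 < d)%N -> trivIset setT shell.
Proof.
move=> d0; suff lt_shell j k v : (j < k)%N -> shell j v -> shell k v -> False.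
  apply/trivIsetP => j k _ _; rewrite neq_ltn => jk; rewrite -subset0 => v [].
  by case/orP : jk => [/lt_shell H /H|/lt_shell H /[swap] /H]; exact.
move=> jk /(_ (Ordinal d0)) + /(_ (Ordinal d0)); rewrite /= !in_itv/=.
have : (4 ^+ j.+1 : R) <= 4 ^+ k by rewrite ler_eXn2l// ltr1n.
by rewrite exprS => ? ? ?; have := exp4_gt0 j; lra.
Qed.

(** The particles of the shell that are near the origin at time c. *)
Definition slab k c : set ('rV[R]_d * 'rV[R]_d) :=
  [set z : 'rV[R]_d * 'rV[R]_d | shell k z.2 /\
           forall i, z.1 ord0 i + c * z.2 ord0 i \in `[-2, 2[].

Lemma measurable_slab k c : measurable (slab k c).
Proof.
apply: measurableI.
  rewrite -[X in measurable X]setTI; apply: measurable_snd => //.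
  exact: measurable_cube.
apply: (measurable_coords
  (f := fun i (z : 'rV[R]_d * 'rV[R]_d) => z.1 ord0 i + c * z.2 ord0 i)
  (A := fun=> `[-2, 2[%classic)) => //.
move=> i; apply: measurable_funD.
  exact: (measurableT_comp (measurable_coord i) measurable_fst).
apply: measurable_funM => //.
exact: (measurableT_comp (measurable_coord i) measurable_snd).
Qed.

(** At fixed velocity in the shell, the slice in x is a translate of a cube of
    side 4. *)
Lemma lebesgue_slab k c :
  ((lebesgue_rV d \x lebesgue_rV d) (slab k c) =
   (4 ^+ d * (4 ^+ k) ^+ d)%:E)%E.
Proof.
rewrite product_measure_ysection; last exact: measurable_slab.
rewrite EFinM -lebesgue_shell -integral_cst; last exact: measurable_cube.
rewrite [RHS]integral_mkcond; apply: eq_integral => v _; rewrite patchE.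
case: ifPn => [|/negP]; rewrite inE => vk.
  transitivity (((2 - (- 2) : R) ^+ d)%:E); last by congr ((_ ^+ d)%:E); lra.
  rewrite -(lebesgue_rV_translated_cube (fun i => c * v ord0 i)); last by lra.
  congr (lebesgue_rV d _); apply/seteqP; split => x; rewrite /ysection/= inE.
    by case.
  by split.
rewrite (_ : ysection _ _ = set0) ?measure0//; apply/seteqP; split => // x.
by rewrite /ysection/= inE => -[].
Qed.

(** Times are discretized with step [1 / (2 * 4 ^+ k)], during which a particle
    of the shell moves by less than 1 in each coordinate.  A finite union
    makes measurability and the bound on the measure immediate. *)
Definition tube k : set ('rV[R]_d * 'rV[R]_d) :=
  \bigcup_(m in `I_(2 * 4 ^ k).+1) slab k (m%:R / (2 * 4 ^+ k)).

Lemma measurable_tube k : measurable (tube k).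
Proof. by apply: bigcup_measurable => m _; exact: measurable_slab. Qed.

Lemma tube_sub_shell k z : tube k z -> shell k z.2.
Proof. by move=> [m _ []]. Qed.

Lemma trivIset_tube : (0 < d)%N -> trivIset setT tube.
Proof.
move=> /trivIset_shell tS j k _ _ [z [/tube_sub_shell jz /tube_sub_shell kz]].
by apply: tS => //; exists z.2.
Qed.

(** There are [2 * 4 ^ k + 1 <= 3 * 4 ^ k] slabs, each of measure
    [4 ^ d * 4 ^ (k d)]. *)
Lemma lebesgue_tube_le k :
  ((lebesgue_rV d \x lebesgue_rV d) (tube k) <=
   (3 * 4 ^+ d * (4 ^+ k) ^+ d.+1)%:E)%E.
Proof.
apply: le_trans.
  apply: (@content_subadditive _ _ _ _ (tube k)
    (fun m => slab k (m%:R / (2 * 4 ^+ k))) (2 * 4 ^ k).+1) => //.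
  - by move=> m _; exact: measurable_slab.
  - exact: measurable_tube.
  - by rewrite /tube bigcup_mkord.
rewrite (eq_bigr (fun=> (4 ^+ d * (4 ^+ k) ^+ d)%:E)) => [|m _]; last first.
  exact: lebesgue_slab.
rewrite sumEFin lee_fin sumr_const card_ord -[leLHS]mulr_natl.
rewrite (_ : 3 * _ * _ = (3 * 4 ^+ k) * (4 ^+ d * (4 ^+ k) ^+ d)); last first.
  by rewrite exprS; ring.
rewrite ler_pM2r ?mulr_gt0 ?exprn_gt0//.
rewrite -natr1 natrM natrX.
have : 1 <= 4 ^+ k :> R by rewrite exprn_ege1// ler1n.
by lra.
Qed.

(** All particles that pass through the unit cube at a time t in [0, 1] start
    in the tube: if s is the discretized time just below t, then
    x - t v + s v differs from x by less than 1 in each coordinate. *)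
Lemma tube_flow k (t : R) x v : 0 <= t <= 1 -> cube 0 1 x -> shell k v ->
  tube k (x - t *: v, v).
Proof.
move=> /andP[t0 t1] x01 vk; have k0 := exp4_gt0 k.
have l0 : 0 < 2 * 4 ^+ k :> R by rewrite mulr_gt0.
pose m := Num.truncn (t * (2 * 4 ^+ k)).
have /andP[mt tm] : m%:R <= t * (2 * 4 ^+ k) < m.+1%:R.
  by apply: truncn_itv; rewrite mulr_ge0// ltW.
exists m => /=.
  rewrite ltnS -(ler_nat R) (le_trans mt)// natrM natrX.
  by rewrite ler_piMl// ltW.
split => // i /=; rewrite !mxE.
have /= := x01 i; have /= := vk i.
rewrite !in_itv/= => /andP[v1 v2] /andP[x0 x1].
have v0 : 0 < v ord0 i by lra.
set s := m%:R / _.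
have st : s <= t by rewrite ler_pdivrMr.
have ts : (t - s) * v ord0 i < 1.
  have : (t - s) < (2 * 4 ^+ k)^-1.
    by rewrite -[ltRHS]mul1r ltr_pdivlMr// mulrBl divfK ?gt_eqF//; move: tm;
      rewrite -natr1; lra.
  move=> h; apply: (@le_lt_trans _ _ ((t - s) * (2 * 4 ^+ k))).
    by apply: ler_wpM2l; lra.
  by rewrite -ltr_pdivlMr// mul1r.
have ts0 : 0 <= (t - s) * v ord0 i by rewrite mulr_ge0 ?subr_ge0// ltW.
by apply/andP; split; lra.
Qed.

End boxes.

(** * The counterexample *)

Section datum.
Context {R : realType} (d : nat) (d0 : (0 < d)%N).
Implicit Types (x v : 'rV[R]_d) (n k : nat).

Let r : R := (2 * d)%N%:R / d.+1%:R.

Let r0 : 0 < r. Proof. by rewrite divr_gt0// ltr0n// muln_gt0. Qed.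

(** Calibrated so that its square is the inverse of [4 ^ (k (d + 1))], the
    order of the measure of the tube, and its r-th power the inverse of the
    measure of the shell. *)
Definition weight k : R := (4 ^+ k) `^ (- (d.+1%:R / 2)).

Lemma weight_ge0 k : 0 <= weight k. Proof. exact: powR_ge0. Qed.

Lemma weight_powR k (s : R) n : d.+1%:R * s = 2 * n%:R ->
  weight k `^ s = ((4 ^+ k) ^+ n)^-1.
Proof.
move=> sn; rewrite -powRrM (_ : _ * s = - n%:R).
  by rewrite powRN powR_mulrn.
rewrite mulNr mulrAC sn; lra.
Qed.

Definition datum n (z : 'rV[R]_d * 'rV[R]_d) : R :=
  \sum_(k < n) weight k * \1_(tube k) z.

Lemma measurable_datum n : measurable_fun setT (datum n).
Proof.
apply: measurable_sum => k; apply: measurable_funM => //.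
by apply: measurable_indic; exact: measurable_tube.
Qed.

Lemma L2norm_datum_le n :
  ('N[lebesgue_rV d \x lebesgue_rV d]_2%:E [(fun z => (datum n z)%:E)] <=
   ((3 * 4 ^+ d * n%:R) `^ 2^-1)%:E)%E.
Proof.
rewrite Lnorm_sum_indic//; last 3 first.
- exact: weight_ge0.
- exact: measurable_tube.
- exact: trivIset_tube.
rewrite -poweR_EFin; apply: gt0_ler_poweR => //.
- rewrite in_itv/= leey andbT sume_ge0// => k _.
  by rewrite mule_ge0// lee_fin powR_ge0.
- by rewrite in_itv/= leey andbT lee_fin !mulr_ge0.
apply: (@le_trans _ _ (\sum_(k < n) (3 * 4 ^+ d)%:E)%E); last first.
  by rewrite sumEFin sumr_const card_ord mulr_natr.
apply: lee_sum => k _.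
have wE : weight k `^ 2 = ((4 ^+ k) ^+ d.+1)^-1.
  by apply: weight_powR; rewrite mulrC.
have w0 : (0 <= (weight k `^ 2)%:E :> \bar R)%E by rewrite lee_fin powR_ge0.
apply: (le_trans (lee_wpmul2l w0 (lebesgue_tube_le d k))).
by rewrite wE -EFinM lee_fin mulrC mulfK// !expf_neq0.
Qed.

Lemma datum_Lfun n : datum n \in Lfun (lebesgue_rV d \x lebesgue_rV d)%E 2%:E.
Proof.
apply/andP; split; rewrite inE/=.
  exact: measurable_datum.
by rewrite /finite_norm (le_lt_trans (L2norm_datum_le n))// ltry.
Qed.

(** Near the origin and during [0, 1] the solution does not depend on (t, x):
    particles of all velocities in the shells are present at once. *)
Lemma transport_datum n (t : R) x v : 0 <= t <= 1 -> cube 0 1 x ->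
  transport (datum n) t x v = \sum_(k < n) weight k * \1_(shell k) v.
Proof.
move=> t01 x01; apply: eq_bigr => k _; congr (_ * _).
rewrite !indicE; congr ((_ : bool)%:R).
apply/idP/idP; rewrite !inE; first exact: tube_sub_shell.
exact: tube_flow.
Qed.

Lemma velocity_norm_transport_datum n (t : R) x : 0 <= t <= 1 -> cube 0 1 x ->
  ('N[lebesgue_rV d]_(endpoint_v d)
     [(fun v => (transport (datum n) t x v)%:E)] = (n%:R `^ r^-1)%:E)%E.
Proof.
move=> t01 x01; under eq_Lnorm do rewrite transport_datum//.
rewrite Lnorm_sum_indic//; last 3 first.
- exact: weight_ge0.
- by move=> k; exact: measurable_cube.
- exact: trivIset_shell.
rewrite -poweR_EFin; congr (_ `^ _)%E.
rewrite (eq_bigr (fun=> 1%E)) => [|k _].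
  by rewrite sumEFin sumr_const card_ord.
rewrite (@weight_powR k r d); last first.
  by rewrite mulrC divfK// natrM.
transitivity (((((4 ^+ k) ^+ d)^-1 : R)%:E * ((4 ^+ k) ^+ d)%:E)%E).
  by congr (_ * _)%E; exact: lebesgue_shell.
by rewrite -EFinM mulVf// !expf_neq0.
Qed.

Lemma endpoint_x_gt0 : (0 < endpoint_x d :> \bar R)%E.
Proof.
rewrite /endpoint_x; case: ifPn => // d1; rewrite lte_fin divr_gt0 ?ltr0n//.
  by rewrite muln_gt0.
by case: d d0 d1 => // -[].
Qed.

Lemma mixed_norm_datum_ge n :
  ((n%:R `^ r^-1)%:E <=
   mixed_norm 2%:E (endpoint_x d) (endpoint_v d) (transport (datum n)))%E.
Proof.
have c0 : (0 <= (n%:R `^ r^-1)%:E :> \bar R)%E by rewrite lee_fin powR_ge0.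
rewrite /mixed_norm.
apply: (@Lnorm_ge_unit _ _ _ lebesgue_measure _ _ `[0, 1]%classic) => //.
  have := lebesgue_measure_itv `[0 : R, 1].
  by rewrite /= lte_fin ltr01 oppr0 adde0.
move=> t /=; rewrite in_itv/= => t01; rewrite gee0_abs ?Lnorm_ge0//.
apply: (Lnorm_ge_unit (A := cube 0 1)) => //; first exact: endpoint_x_gt0.
- exact: measurable_cube.
- by have := @lebesgue_rV_cube R d 0 1 ler01; rewrite subr0 expr1n.
move=> x x01; rewrite gee0_abs ?Lnorm_ge0//.
by rewrite velocity_norm_transport_datum.
Qed.

End datum.

Theorem theorem1 (R : realType) (d : nat) (hd : (1 <= d)%N) :
  ~ exists C : R, forall f0 : 'rV[R]_d * 'rV[R]_d -> R,
      f0 \in Lfun (lebesgue_rV d \x lebesgue_rV d)%E 2%:E ->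
      (mixed_norm 2%:E (endpoint_x d) (endpoint_v d) (transport f0) <=
       C%:E * 'N[lebesgue_rV d \x lebesgue_rV d]_2%:E [(fun z => (f0 z)%:E)])%E.
Proof.
move=> [C strichartz].
pose r : R := (2 * d)%N%:R / d.+1%:R; pose e : R := (2 * d)%N%:R^-1.
have e0 : 0 < e by rewrite invr_gt0 ltr0n muln_gt0.
have rE : r^-1 = 2^-1 + e.
  rewrite /r /e invf_div natrM -natr1; field.
  by rewrite pnatr_eq0 -lt0n.
pose B := `|C| * (3 * 4 ^+ d) `^ 2^-1.
(* Dividing n^(1/r) <= C (3 4^d n)^(1/2) by n^(1/2) leaves a positive
   power of n that stays bounded. *)
have growth n : (0 < n)%N -> n%:R `^ e <= B.
  move=> n0; have npos : 0 < (n%:R : R) `^ 2^-1 by rewrite powR_gt0// ltr0n.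
  rewrite -(ler_pM2l npos) -powRD; last by rewrite pnatr_eq0 -lt0n n0 implybT.
  rewrite -rE mulrC -mulrA -powRM ?mulr_ge0// -lee_fin EFinM.
  apply: le_trans (mixed_norm_datum_ge hd n) _.
  apply: le_trans (strichartz _ (datum_Lfun hd n)) _.
  apply: (@le_trans _ _ (`|C|%:E *
    'N[lebesgue_rV d \x lebesgue_rV d]_2%:E [(fun z => (datum n z)%:E)])%E).
    by apply: lee_wpmul2r; rewrite ?Lnorm_ge0// lee_fin ler_norm.
  by apply: lee_wpmul2l; [rewrite lee_fin|exact: L2norm_datum_le].
pose n := (Num.truncn (B `^ e^-1)).+1.
have : n%:R <= B `^ e^-1.
  have -> : n%:R = (n%:R `^ e) `^ e^-1.
    by rewrite -powRrM mulfV ?gt_eqF// powRr1.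
  apply: ge0_ler_powR; rewrite ?nnegrE ?powR_ge0 ?invr_ge0 ?(ltW e0)//.
    by rewrite mulr_ge0 ?powR_ge0.
  exact: growth.
by rewrite leNgt truncnS_gt.
Qed.
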